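(* Let $\Delta$ be a finite simplicial complex with vertex set $V$, let $f:V\to\mathbb{R}$ be injective and discrete smooth on $\Delta$, and let $M$ be the greedy matching on the weighted Hasse diagram of $\Delta$. If $\sigma\in\Delta$ is critical, then for all $\tau\succ\sigma$ one has $\tau\setminus h_f(\sigma)\rightarrow\tau$.
   Context: A finite simplicial complex $\Delta$ with (nonempty, finite) vertex set $V$ is a family of subsets of $V$ (simplices) containing every singleton $\{v\}$, $v\in V$, and closed under taking subsets (so $\emptyset\in\Delta$, of dimension $-1$). $\dim\sigma=|\sigma|-1$. We write $\sigma\prec\tau$ (or $\tau\succ\sigma$), ''$\sigma$ is a facet of $\tau$'', if $\sigma\subset\tau$ and $\dim\sigma=\dim\tau-1$. A vertex $v$ is identified with $\{v\}$ in expressions such as $\sigma\setminus v$, $\sigma\cup v$. The Hasse diagram $H$ of $\Delta$ has the simplices of $\Delta$ as nodes and an arc $\{\sigma,\tau\}$ for each pair $\sigma\prec\tau$. The weight of the arc $\{\sigma,\tau\}$ is $f(v)$, where $\tau\setminus\sigma=\{v\}$. Two arcs sharing a node always have different weights. Greedy matching $M$: start with $M=\emptyset$; while arcs remain, add all remaining arcs of minimum weight to $M$ and delete the end nodes of these arcs (with all their incident arcs). We write $\sigma\rightarrow\tau$ if $\sigma\prec\tau$ and $\{\sigma,\tau\}\in M$. A simplex is critical if it belongs to no arc of $M$. For $\sigma\in\Delta$, $H(\sigma)=\{v\in V:\ v\in\sigma,\text{ or } v\notin\sigma\text{ and }\sigma\cup\{v\}\in\Delta\}$ (the vertices whose $f$-values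 are the weights of the arcs incident to $\sigma$), and $h_f(\sigma)$ is the unique vertex of $H(\sigma)$ at which $f$ is minimal. A simplex $\sigma\in\Delta$ is discrete smooth if: whenever $h_f(\sigma)\in\sigma$, then for all $\tau\succ\sigma$ one has $h_f(\tau\setminus h_f(\sigma))=h_f(\sigma)$. The function $f$ is discrete smooth on $\Delta$ if every $\sigma\in\Delta$ is discrete smooth. *)

(* Defs.v *)
From HB Require Import structures.
From mathcomp Require Import all_boot all_order all_algebra.
From mathcomp Require Import reals.

Set Implicit Arguments.
Unset Strict Implicit.
Unset Printing Implicit Defensive.

Import Order.TTheory GRing.Theory Num.Theory.

Local Open Scope ring_scope.

Section Complex.
Variable V : finType.
Implicit Types (Delta N : {set {set V}}) (sigma tau : {set V}).
Implicit Types (a b : {set V} * {set V}).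

(* The vertex set is the whole type V; the empty simplex is a consequence of
   closure under subsets as soon as V is inhabited. *)
Definition simplicial_complex Delta : Prop :=
  (forall v : V, [set v] \in Delta) /\
  (forall sigma tau, tau \in Delta -> sigma \subset tau -> sigma \in Delta).

Definition dim sigma : int := #|sigma|%:Z - 1.

Definition facet sigma tau : bool :=
  (sigma \subset tau) && (dim sigma == dim tau - 1).

(* An arc is stored as the pair (smaller simplex, larger simplex). *)
Definition arcs N : {set {set V} * {set V}} :=
  [set a | [&& a.1 \in N, a.2 \in N & facet a.1 a.2]].

Definition incident sigma a : bool := (sigma == a.1) || (sigma == a.2).

Section Weighted.
Variable R : realType.
Variable f : V -> R.

(* [unset1 A] is [Some v] when A = [set v]; this is the case for every arc, so
   the value 0 is never used. *)
Definition weight a : R :=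
  if unset1 (a.2 :\: a.1) is Some v then f v else 0.

Definition min_arcs N : {set {set V} * {set V}} :=
  [set a in arcs N | [forall b in arcs N, weight a <= weight b]].

(* The state is (arcs selected so far, nodes not yet deleted); a node deletion
   removes the incident arcs, so the remaining arcs are [arcs] of the remaining
   nodes. *)
Definition greedy_step (s : {set {set V} * {set V}} * {set {set V}}) :=
  (s.1 :|: min_arcs s.2,
   [set sigma in s.2 | ~~ [exists a in min_arcs s.2, incident sigma a]]).

Definition greedy_state Delta (n : nat) := iter n greedy_step (set0, Delta).

(* A step does nothing once no arc remains, and deletes nodes otherwise, so
   #|Delta| steps exhaust the loop: see [greedy_matching_done]. *)
Definition greedy_matching Delta : {set {set V} * {set V}} :=
  (greedy_state Delta #|Delta|).1.

Definition matched Delta sigma tau : bool :=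
  facet sigma tau && ((sigma, tau) \in greedy_matching Delta).

Definition critical Delta sigma : Prop :=
  sigma \in Delta /\
  (forall a, a \in greedy_matching Delta -> ~~ incident sigma a).

Definition Hset Delta sigma : {set V} :=
  [set v | (v \in sigma) || (v \notin sigma) && (v |: sigma \in Delta)].

(* [v0] is only the default value required by [arg min]: on a simplex the
   result does not depend on it, see [hfP]. *)
Definition hf Delta (v0 : V) sigma : V :=
  [arg min_(v < v0 in Hset Delta sigma) f v]%O.

Definition discrete_smooth_at Delta (v0 : V) sigma : Prop :=
  let h := hf Delta v0 in
  h sigma \in sigma ->
  forall tau, tau \in Delta -> facet sigma tau ->
    h (tau :\ h sigma) = h sigma.

Definition discrete_smooth Delta (v0 : V) : Prop :=
  forall sigma, sigma \in Delta -> discrete_smooth_at Delta v0 sigma.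

Lemma min_arcs_neq0 N : arcs N != set0 -> min_arcs N != set0.
Proof.
case/set0Pn => a0 a0N; apply/set0Pn.
case: (@arg_minP _ _ _ a0 (mem (arcs N)) weight a0N) => a aN amin.
exists a; rewrite inE; apply/andP; split; first exact: aN.
by apply/forallP => b; apply/implyP => bN; apply: amin.
Qed.

Lemma greedy_step_card s :
  arcs s.2 != set0 -> (#|(greedy_step s).2| < #|s.2|)%N.
Proof.
move=> /min_arcs_neq0 /set0Pn [a am]; apply: proper_card.
rewrite /greedy_step /=; apply/properP; split.
  by apply/subsetP => x; rewrite inE => /andP[].
exists a.1.
  by move: am; rewrite inE => /andP[]; rewrite inE => /and3P[].
rewrite inE negb_and negbK; apply/orP; right; apply/existsP; exists a.
by rewrite am /incident eqxx.
Qed.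

Lemma greedy_matching_done Delta :
  arcs (greedy_state Delta #|Delta|).2 = set0.
Proof.
suff H n : arcs (greedy_state Delta n).2 = set0 \/
           (#|(greedy_state Delta n).2| + n <= #|Delta|)%N.
  case: (H #|Delta|) => //; rewrite -{3}[#|Delta|]add0n leq_add2r leqn0.
  rewrite cards_eq0 => /eqP ->.
  by apply/setP => a; rewrite !inE.
elim: n => [|n IH]; first by right; rewrite addn0.
rewrite /greedy_state iterS -/(greedy_state Delta n).
set s := greedy_state Delta n in IH *.
have [s0|sN0] := eqVneq (arcs s.2) set0.
  left; apply/eqP; rewrite -subset0 -s0; apply/subsetP => a.
  by rewrite !inE => /and3P[/andP[-> _] /andP[-> _] ->].
right; case: IH => [s0|le_s]; first by rewrite s0 eqxx in sN0.
apply: leq_trans le_s; rewrite addnS -addSn leq_add2r.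
exact: greedy_step_card.
Qed.

Lemma hfP Delta v0 sigma : simplicial_complex Delta -> injective f ->
  sigma \in Delta ->
  forall v, (v = hf Delta v0 sigma) <->
    (v \in Hset Delta sigma /\
     forall u, u \in Hset Delta sigma -> f v <= f u).
Proof.
move=> [Dv _] finj sD.
have [w wH] : exists w, w \in Hset Delta sigma.
  have [s0|[w ws]] := set_0Vmem sigma; last by exists w; rewrite inE ws.
  by exists v0; rewrite inE s0 in_set0 setU0 Dv.
have [hH hmin] : hf Delta v0 sigma \in Hset Delta sigma /\
    forall u, u \in Hset Delta sigma -> f (hf Delta v0 sigma) <= f u.
  rewrite /hf /Order.arg_min /extremum; case: pickP => [x|no] /=.
    case/andP => xH /forallP xm; split => // u uH.
    by move/implyP: (xm u); apply.
  case: (@arg_minP _ _ _ w (mem (Hset Delta sigma)) f wH) => x xH xm.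
  move: (no x) => /negP[]; apply/andP; split; first exact: xH.
  by apply/forallP => u; apply/implyP; apply: xm.
move=> v; split=> [->|[vH vm]]; first by split.
by apply: finj; apply/eqP; rewrite eq_le vm // hmin.
Qed.

End Weighted.
End Complex.

(* Main.v *)
(* The greedy algorithm rejects an arc only because of a strictly lighter
   matched arc sharing an end node with it. The sets [Hset] shrink as simplices
   grow, so an arc whose weight is minimal at its lower end is minimal at both
   ends, hence matched. With h = hf sigma, this shows that h belongs to a
   critical sigma, for otherwise the arc from sigma to h |: sigma would be
   matched. Smoothness at sigma then says that the arc from tau :\ h to tau is
   minimal at its lower end. *)

Require Import Defs.
From HB Require Import structures.
From mathcomp Require Import all_boot all_order all_algebra.
From mathcomp Require Import reals.

Set Implicit Arguments.
Unset Strict Implicit.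
Unset Printing Implicit Defensive.

Import Order.TTheory GRing.Theory Num.Theory.

Section GreedyMatching.
Variables (R : realType) (V : finType) (f : V -> R) (Delta : {set {set V}}).
Implicit Types (N : {set {set V}}) (sigma tau : {set V}).
Implicit Types (a b : {set V} * {set V}).

(** Trades the dimension equation for the added vertex, which gives the arc its weight. *)
Lemma facetP sigma tau :
  reflect (exists2 v, v \notin sigma & tau = v |: sigma) (facet sigma tau).
Proof.
apply: (iffP andP) => [[sub /eqP dim_eq]|[v vNs ->]]; last first.
  by split; [exact: subsetUr | rewrite /Defs.dim cardsU1 vNs add1n -addn1 PoszD addrK].
have card_tau : #|tau| = #|sigma|.+1.
  by apply/eqP; rewrite -eqz_nat -addn1 PoszD (addIr _ dim_eq) subrK.
have /cards1P[v tauDsigma] : #|tau :\: sigma| == 1%N.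
  by rewrite cardsD (setIidPr sub) card_tau subSnn.
have := set11 v; rewrite -tauDsigma inE => /andP[vNs _]; exists v => //.
by rewrite -tauDsigma setUC -{1}(setID tau sigma) (setIidPr sub).
Qed.

Lemma weightU1 sigma v : v \notin sigma -> weight f (sigma, v |: sigma) = f v.
Proof.
move=> vNs; rewrite /weight /= setDUl setDv setU0.
have -> : [set v] :\: sigma = [set v].
  by apply/setDidPl; rewrite disjoints1.
by rewrite set1K.
Qed.

Lemma sub_arcs N N' : N \subset N' -> arcs N \subset arcs N'.
Proof.
move=> /subsetP sub; apply/subsetP => a; rewrite !inE => /and3P[a1 a2 ->].
by rewrite !sub.
Qed.

Lemma greedy_step_nodes s : (greedy_step f s).2 \subset s.2.
Proof. by apply/subsetP => sigma; rewrite inE => /andP[]. Qed.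

(** The two inclusions are proved together: newly selected arcs join remaining nodes, so they lie in
    [arcs Delta] only because those nodes lie in [Delta]. *)
Lemma greedy_state_sub n :
  ((greedy_state f Delta n).1 \subset arcs Delta)
  && ((greedy_state f Delta n).2 \subset Delta).
Proof.
elim: n => [|n /andP[IH1 IH2]]; first by rewrite sub0set subxx.
rewrite /greedy_state iterS -/(greedy_state f Delta n).
rewrite (subset_trans (greedy_step_nodes _)) // andbT subUset IH1 /=.
apply: subset_trans (sub_arcs IH2).
by apply/subsetP => a; rewrite inE => /andP[].
Qed.

Lemma greedy_matching_sub : greedy_matching f Delta \subset arcs Delta.
Proof. by have /andP[] := greedy_state_sub #|Delta|. Qed.

(** The certificate that an arc was rejected; its strict inequality will contradict minimality at an
    end node. *)
Definition outweighed (M : {set {set V} * {set V}}) a : Prop :=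
  exists b, [/\ b \in M, incident a.1 b || incident a.2 b
              & (weight f b < weight f a)%R].

(** A loop invariant. Selected arcs stay selected, so the last two cases persist; an arc leaves the
    first case by being selected or by losing an end node. *)
Lemma greedy_state_cases n a : a \in arcs Delta ->
  [\/ a \in arcs (greedy_state f Delta n).2, a \in (greedy_state f Delta n).1
    | outweighed (greedy_state f Delta n).1 a].
Proof.
move=> aD; elim: n => [|n IH]; first by constructor 1.
rewrite /greedy_state iterS -/(greedy_state f Delta n).
move: (greedy_state f Delta n) IH => s [aN|aM|[b [bM inc lt_ba]]]; last 2 first.
- by constructor 2; rewrite inE aM.
- by constructor 3; exists b; rewrite inE bM.
have [amin|aNmin] := boolP (a \in min_arcs f s.2).
  by constructor 2; rewrite inE amin orbT.
(* All minimal arcs are selected at once: if [a] were no heavier than the minimal arc [b], it would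
   be minimal too. Hence the deleting arc is strictly lighter. *)
have deleted sigma b : sigma \in [set a.1; a.2] -> b \in min_arcs f s.2 ->
    incident sigma b -> outweighed (greedy_step f s).1 a.
  move=> sigma_a bmin inc; exists b; split; first by rewrite inE bmin orbT.
    by case/set2P: sigma_a => <-; rewrite inc ?orbT.
  rewrite ltNge; apply: contra aNmin => le_ab; rewrite inE aN /=.
  apply/forallP => c; apply/implyP => cN; apply: le_trans le_ab _.
  by move: bmin; rewrite inE => /andP[_ /forallP /(_ c)]; rewrite cN.
have [/existsP[b /andP[bmin inc]]|keep1] :=
    boolP [exists b in min_arcs f s.2, incident a.1 b].
  by constructor 3; apply: deleted bmin inc; rewrite set21.
have [/existsP[b /andP[bmin inc]]|keep2] :=
    boolP [exists b in min_arcs f s.2, incident a.2 b].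
  by constructor 3; apply: deleted bmin inc; rewrite set22.
constructor 1; move: aN; rewrite !inE => /and3P[-> -> ->].
by rewrite keep1 keep2.
Qed.

Lemma greedy_matching_maximal a : a \in arcs Delta ->
  a \in greedy_matching f Delta \/ outweighed (greedy_matching f Delta) a.
Proof.
move=> /(greedy_state_cases #|Delta|).
by rewrite greedy_matching_done inE => -[|aM|out] //; [left | right].
Qed.

Hypothesis Delta_complex : simplicial_complex Delta.

Lemma Hset_anti sigma tau :
  tau \in Delta -> sigma \subset tau -> Hset Delta tau \subset Hset Delta sigma.
Proof.
have [_ closed] := Delta_complex.
move=> tauD sub; apply/subsetP => v; rewrite !inE => vH.
have [//|/= _] := boolP (v \in sigma).
case/orP: vH => [v_tau|/andP[_ vD]].
  by apply: closed tauD _; rewrite subUset sub1set v_tau.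
by apply: closed vD _; apply: setUS.
Qed.

(** The vertex added along an arc belongs to the upper end and extends the lower end, so it lies in
    [Hset] of both. *)
Lemma weight_incident sigma a : a \in arcs Delta -> incident sigma a ->
  exists2 v, v \in Hset Delta sigma & weight f a = f v.
Proof.
case: a => rho tau; rewrite inE /= => /and3P[_ tauD /facetP[v vNr tau_eq]] inc.
rewrite {}tau_eq in tauD inc *; exists v; last exact: weightU1.
by case/orP: inc => /eqP ->; rewrite inE /= ?setU11 ?(negbTE vNr).
Qed.

Lemma locally_min_arc_matched sigma v :
  v \notin sigma -> v |: sigma \in Delta ->
  (forall u, u \in Hset Delta sigma -> (f v <= f u)%R) ->
  (sigma, v |: sigma) \in greedy_matching f Delta.
Proof.
move=> vNs vsD vmin; have [_ closed] := Delta_complex.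
have sub : sigma \subset v |: sigma by apply: subsetUr.
have aD : (sigma, v |: sigma) \in arcs Delta.
  by rewrite inE /= vsD (closed _ _ vsD sub); apply/facetP; exists v.
have [//|[b [bM inc]]] := greedy_matching_maximal aD.
have bD := subsetP greedy_matching_sub b bM.
suff [u uH ->] : exists2 u, u \in Hset Delta sigma & weight f b = f u.
  by rewrite weightU1 // ltNge vmin.
(* If [b] meets the upper end [v |: sigma], its vertex still lies in [Hset Delta sigma] by
   antitonicity. *)
case/orP: inc => /(weight_incident bD) //= [u uH ->].
by exists u => //; apply: subsetP (Hset_anti vsD sub) u uH.
Qed.

End GreedyMatching.

Theorem theorem21 (R : realType) (V : finType) (v0 : V)
    (Delta : {set {set V}}) (f : V -> R)
    (Delta_complex : simplicial_complex Delta)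
    (f_inj : injective f)
    (f_smooth : discrete_smooth f Delta v0)
    (sigma : {set V}) (sigma_critical : critical f Delta sigma) :
  forall tau : {set V}, tau \in Delta -> facet sigma tau ->
    matched f Delta (tau :\ hf f Delta v0 sigma) tau.
Proof.
move=> tau tauD sigma_tau; have [sD unmatched] := sigma_critical.
have [_ closed] := Delta_complex.
set h := hf f Delta v0 sigma.
have [hH hmin] := (hfP v0 Delta_complex f_inj sD h).1 erefl.
have h_sigma : h \in sigma.
  apply: contraT => hNs; move: hH; rewrite inE (negbTE hNs) /= => hsD.
  have /unmatched := locally_min_arc_matched Delta_complex hNs hsD hmin.
  (* The matched arc has [sigma] as its lower end, against criticality. *)
  by rewrite /incident eqxx.
have h_tau : h \in tau by case/andP: sigma_tau => /subsetP ->.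
have rhoD : tau :\ h \in Delta by apply: closed tauD _; apply: subsetDl.
have h_rho : h = hf f Delta v0 (tau :\ h) by rewrite (f_smooth _ sD).
have [_ hmin_rho] := (hfP v0 Delta_complex f_inj rhoD h).1 h_rho.
have hN : h \notin tau :\ h by rewrite !inE eqxx.
have tauE := setD1K h_tau.
apply/andP; split; first by apply/facetP; exists h.
(* Only the upper end is rewritten, giving the arc the form [(rho, h |: rho)] with [rho] equal to
   [tau :\ h]. *)
rewrite -{2}tauE; apply: locally_min_arc_matched => //.
by rewrite tauE.
Qed.
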